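(* Let $\ell\in\mathbb{N}$ and $p>1$. Suppose that $\mathfrak{g}\in H^\ell$ satisfies $$\nabla^k\mathfrak{g}_n>0\quad\text{for all } n\ge\ell \text{ and } k\in\{0,\dots,\ell\},$$ $$-\Delta_p^{(\ell-k)}\nabla^{k}\mathfrak{g}_{n}\ge 0\quad\text{for all } n\ge\ell \text{ and } k\in\{1,\dots,\ell-1\},$$ $$-\Delta_p^{(\ell)}\mathfrak{g}_n\ge0\quad\text{for all } n\ge\ell.$$ Then the sequence $\rho(\mathfrak{g})=\{\rho_n(\mathfrak{g})\}_{n\ge\ell}$, $\rho_n(\mathfrak{g}):=\dfrac{-\Delta_p^{(\ell)}\mathfrak{g}_n}{\mathfrak{g}_n^{p-1}}$, is a discrete $p$-Hardy--Rellich--Birman weight (of order $\ell$), which is non-attainable in $\mathcal{H}_0^\ell$.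
   Context: $\mathbb{N}=\{1,2,\dots\}$. $C(\mathbb{Z})$ is the space of complex sequences indexed by $\mathbb{Z}$, and $C_0(\mathbb{Z})$ its subspace of finitely supported sequences. For $u\in C(\mathbb{Z})$ put $\nabla u_n=(\nabla u)_n:=u_n-u_{n-1}$ and $\mathrm{div}\,u_n=(\mathrm{div}\,u)_n:=u_{n+1}-u_n$, $n\in\mathbb{Z}$; the $0$-th power of an operator is the identity. $H^\ell:=\{u\in C(\mathbb{Z}) : u_n=0 \text{ for all } n<\ell\}$ and $\mathcal{H}_0^\ell:=H^\ell\cap C_0(\mathbb{Z})$. For $\nu\in\mathbb{C}$ and $a>0$, $\nu^{\langle a\rangle}:=\nu|\nu|^{a-1}$ with $0^{\langle a\rangle}:=0$ (applied entrywise to sequences). For an integer $m\ge0$, the discrete $p$-Laplacian of order $m$ is $-\Delta_p^{(m)}u:=(-1)^m\,\mathrm{div}^m\bigl((\nabla^m u)^{\langle p-1\rangle}\bigr)$; in particular $-\Delta_p^{(0)}u=u^{\langle p-1\rangle}$. The expression $-\Delta_p^{(m)}\nabla^k\mathfrak{g}_n$ denotes the value at $n$ of $-\Delta_p^{(m)}$ applied to the sequence $\nabla^k\mathfrak{g}$. A non-negative sequence $\rho=\{\rho_n\}_{n=\ell}^\infty$ is a discrete $p$-Hardy--Rellich--Birman weight if $$\sum_{n=\ell}^{\infty}\bigl|\nabla^\ell u_n\bigr|^p\ge\sum_{n=\ell}^{\infty}\rho_n|u_n|^p\quad\text{for all } u\in\mathcal{H}_0^\ell.$$ Such a weight is non-attainable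 in $\mathcal{H}_0^\ell$ if, whenever equality holds in this inequality for some $u\in\mathcal{H}_0^\ell$, then $u\equiv0$. *)

(* Defs.v *)
(* Mathematical Components and MathComp-Analysis; complex numbers are the
   type R[i] of mathcomp-real-closed over a realType R. *)
From HB Require Import structures.
From mathcomp Require Import all_boot all_order all_algebra.
From mathcomp Require Import all_classical all_reals all_analysis.
From mathcomp Require Import complex.

Set Implicit Arguments.
Unset Strict Implicit.
Unset Printing Implicit Defensive.

Import Order.TTheory GRing.Theory Num.Theory.
Import numFieldNormedType.Exports.

Local Open Scope classical_set_scope.
Local Open Scope ring_scope.
Local Open Scope complex_scope.

Definition nabla (R : realType) (u : int -> R[i]) : int -> R[i] :=
  fun n => u n - u (n - 1).

Definition div (R : realType) (u : int -> R[i]) : int -> R[i] :=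
  fun n => u (n + 1) - u n.

(* The modulus with values in R; the generic norm `|z| on R[i] lives in R[i]. *)
Definition modc (R : realType) (z : R[i]) : R := Normc.normc z.

(* z |z|^(a-1); the factor z makes the value at z = 0 equal to 0. *)
Definition spow (R : realType) (a : R) (z : R[i]) : R[i] :=
  z * (modc z `^ (a - 1))%:C.

(* The sequence (-1)^m div^m ((nabla^m u)^<p-1>), minus sign included. *)
Definition neg_plaplacian (R : realType) (p : R) (m : nat) (u : int -> R[i]) :
    int -> R[i] :=
  fun n => (-1) ^+ m *
    iter m (@div R) (fun j => spow (p - 1) (iter m (@nabla R) u j)) n.

Definition in_H (R : realType) (l : nat) (u : int -> R[i]) : Prop :=
  forall n : int, n < l%:Z -> u n = 0.

Definition finitely_supported (R : realType) (u : int -> R[i]) : Prop :=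
  finite_set [set n : int | u n != 0].

Definition in_H0 (R : realType) (l : nat) (u : int -> R[i]) : Prop :=
  in_H l u /\ finitely_supported u.

(* The two sides of the inequality are series of non-negative terms, valued
   in the extended reals. *)
Definition HRB_lhs (R : realType) (p : R) (l : nat) (u : int -> R[i]) :
    \bar R :=
  (\sum_(l <= n <oo) (modc (iter l (@nabla R) u n%:Z) `^ p)%:E)%E.

Definition HRB_rhs (R : realType) (p : R) (l : nat) (rho : nat -> R)
    (u : int -> R[i]) : \bar R :=
  (\sum_(l <= n <oo) (rho n * modc (u n%:Z) `^ p)%:E)%E.

(* Only the values rho n with l <= n are relevant. *)
Definition HRB_weight (R : realType) (p : R) (l : nat) (rho : nat -> R) :
    Prop :=
  (forall n : nat, (l <= n)%N -> 0 <= rho n) /\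
  (forall u : int -> R[i], in_H0 l u ->
     (HRB_rhs p l rho u <= HRB_lhs p l u)%E).

Definition non_attainable (R : realType) (p : R) (l : nat) (rho : nat -> R) :
    Prop :=
  forall u : int -> R[i], in_H0 l u ->
    HRB_lhs p l u = HRB_rhs p l rho u -> forall n : int, u n = 0.

(* Weights are real-valued whereas g is a complex sequence: the real parts are
   harmless when g n and neg_plaplacian p l g n are real, in particular when
   they are comparable to 0 for the order of R[i]. *)
Definition rho_of (R : realType) (p : R) (l : nat) (g : int -> R[i]) :
    nat -> R :=
  fun n => complex.Re (neg_plaplacian p l g n%:Z) /
           complex.Re (g n%:Z) `^ (p - 1).

(* Main.v *)
(* With c_k := -Delta_p^(l-k) nabla^k g and phi_k := |nabla^k u|^p /
   (nabla^k g)^(p-1), the sum of c_k phi_k over n >= l is the right-hand side of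
   the inequality for k = 0 and the left-hand side for k = l.  Since
   c_k n = c_(k+1) n - c_(k+1) (n+1), summation by parts and Picone's inequality
   phi_k n - phi_k (n-1) <= phi_(k+1) n show that these sums increase with k.
   Equality for k = l-1, where c_l > 0, propagates zeros of nabla^(l-1) u
   backwards from the end of its support, whence u = 0. *)
Require Import Defs.
From mathcomp Require Import all_boot all_order all_algebra.
From mathcomp Require Import all_classical all_reals all_analysis.
From mathcomp Require Import complex.
From mathcomp Require Import ring zify.

Set Implicit Arguments.
Unset Strict Implicit.
Unset Printing Implicit Defensive.

Import Order.TTheory GRing.Theory Num.Theory.
Local Open Scope ring_scope.
Local Open Scope complex_scope.

(** * Picone's inequality for the ground-state ratios *)

(* Convexity of t^p at the weights B / (B + C) and C / (B + C). *)
Lemma powR_perspective_le (R : realType) (p b d B C : R) :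
  1 <= p -> 0 <= b -> 0 <= d -> 0 < B -> 0 < C ->
  (b + d) `^ p / (B + C) `^ (p - 1) <=
  b `^ p / B `^ (p - 1) + d `^ p / C `^ (p - 1).
Proof.
move=> p1 b0 d0 B0 C0; have A0 : 0 < B + C by rewrite addr_gt0.
(* In perspective form the claim is convexity of t^p at the points [b / B] and [d / C], multiplied
   by [B + C]. *)
have perspE (x X : R) : 0 <= x -> 0 < X ->
    x `^ p / X `^ (p - 1) = X * (x / X) `^ p.
  move=> x0 X0.
  have -> : x `^ p = (x / X) `^ p * X `^ p.
    by rewrite -powRM ?divr_ge0 // ?divfK ?gt_eqF // ltW.
  rewrite -(mulr_powRB1 (ltW X0)) ?(lt_le_trans ltr01 p1)//.
  by rewrite mulrA mulfK ?gt_eqF ?powR_gt0// mulrC.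
rewrite !perspE ?addr_ge0//.
have t01 : 0 <= B / (B + C) <= 1.
  by rewrite ler_pdivrMr// mul1r lerDl (ltW C0) andbT divr_ge0 // ltW.
have /andP[t0 t1] := t01.
have := @convex_powR R p p1 (Itv01 t0 t1) (b / B) (d / C).
rewrite !inE /= !in_itv /= !andbT !divr_ge0 ?(ltW B0) ?(ltW C0)//.
move=> /(_ isT isT).
rewrite convRE [X in X `^ _ <= _]convRE /= => /(ler_wpM2l (ltW A0)).
suff -> : B / (B + C) * (b / B) + unstable.onem (B / (B + C)) * (d / C) =
          (b + d) / (B + C).
  rewrite /unstable.onem.
  suff -> : (1 - B / (B + C)) = C / (B + C).
    rewrite mulrDr !(mulrA (B + C)) ![(B + C) * _ / _]mulrAC.
    by rewrite !divff ?gt_eqF// !mul1r.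
  by field; rewrite gt_eqF.
by rewrite /unstable.onem; field; rewrite !gt_eqF.
Qed.

(* The denominator vanishes outside the support of g, where the ratio takes the
   junk value 0; for u, g in H^l this is the boundary condition at n = l - 1. *)
Definition ground_ratio (R : realType) (p : R) (u g : int -> R[i]) (n : int) :
    R :=
  modc (u n) `^ p / complex.Re (g n) `^ (p - 1).

(** The sum of c_k phi_k, truncated at [N], is the case [m = l - k] for the k-th differences of [u]
    and [g]. *)
Definition energy (R : realType) (p : R) (l m : nat) (u g : int -> R[i])
    (N : nat) : R :=
  \sum_(l <= n < N.+1)
    complex.Re (neg_plaplacian p m g n%:Z) * ground_ratio p u g n%:Z.

Lemma ground_ratio_ge0 (R : realType) (p : R) (u g : int -> R[i]) (n : int) :
  0 <= ground_ratio p u g n.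
Proof. by rewrite divr_ge0 ?powR_ge0. Qed.

Lemma ground_ratio0 (R : realType) (p : R) (u g : int -> R[i]) (n : int) :
  p != 0 -> u n = 0 -> ground_ratio p u g n = 0.
Proof.
by move=> p0 un; rewrite /ground_ratio un /modc Normc.normc0 powR0 ?mul0r.
Qed.

Lemma ground_ratio_eq0 (R : realType) (p : R) (u g : int -> R[i]) (n : int) :
  0 < g n -> ground_ratio p u g n = 0 -> u n = 0.
Proof.
rewrite ltcE => /andP[_ gn] /eqP.
rewrite mulf_eq0 invr_eq0 (gt_eqF (powR_gt0 _ gn)) orbF powR_eq0.
by move=> /andP[/eqP + _]; exact: Normc.eq0_normc.
Qed.

Lemma in_H_nabla (R : realType) (l : nat) (u : int -> R[i]) :
  in_H l u -> in_H l (nabla u).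
Proof. by move=> hu n nl; rewrite /nabla !hu ?subrr//; lia. Qed.

Lemma in_H_iter_nabla (R : realType) (l k : nat) (u : int -> R[i]) :
  in_H l u -> in_H l (iter k (@nabla R) u).
Proof. by move=> hu; elim: k => //= k; exact: in_H_nabla. Qed.

Lemma modc_ge0 (R : realType) (z : R[i]) : 0 <= modc z.
Proof. by case: z => a b; exact: sqrtr_ge0. Qed.

(** The triangle inequality for [u n = u (n - 1) + nabla u n], then [powR_perspective_le] with
    [g (n - 1)] and [nabla g n], whose sum is [g n]. *)
Lemma picone_le (R : realType) (p : R) (l : nat) (u g : int -> R[i]) (n : int) :
  1 < p -> in_H l u -> in_H l g -> (forall j : int, l%:Z <= j -> 0 < g j) ->
  0 < nabla g n -> l%:Z <= n ->
  ground_ratio p u g n <=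
  ground_ratio p u g (n - 1) + ground_ratio p (nabla u) (nabla g) n.
Proof.
move=> p1 hu hg gpos dg ln.
have p0 : 0 < p by rewrite (lt_trans _ p1).
(* At [n = l] both [u (n - 1)] and [g (n - 1)] vanish, and equality holds. *)
have [nl|nl] := ltP (n - 1) l%:Z.
  rewrite (ground_ratio0 _ (lt0r_neq0 p0) (hu _ nl)) add0r.
  by rewrite /ground_ratio /nabla (hu _ nl) (hg _ nl) !subr0.
have := gpos _ nl; rewrite ltcE => /andP[_ B0].
have := dg; rewrite ltcE => /andP[_ C0].
apply: le_trans (powR_perspective_le (ltW p1) (modc_ge0 _) (modc_ge0 _) B0 C0).
rewrite {1}/ground_ratio.
have -> : complex.Re (g n) = complex.Re (g (n - 1)) + complex.Re (nabla g n).
  by rewrite -raddfD /nabla /= addrC subrK.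
rewrite ler_wpM2r ?invr_ge0 ?powR_ge0//.
rewrite ge0_ler_powR ?nnegrE ?addr_ge0 ?modc_ge0 ?(ltW p0)//.
have -> : u n = u (n - 1) + nabla u n by rewrite addrC subrK.
exact: le_normcD.
Qed.

(** * Summation by parts and monotonicity of the energies *)

Lemma neg_plaplacianS (R : realType) (p : R) (m : nat) (g : int -> R[i]) n :
  neg_plaplacian p m.+1 g n =
  neg_plaplacian p m (nabla g) n - neg_plaplacian p m (nabla g) (n + 1).
Proof.
(* The extra sign reverses the outermost difference, the one taken by [div]. *)
rewrite /neg_plaplacian [iter m.+1 (@nabla R) g]iterSr iterS {1}/div exprS.
by rewrite mulN1r mulNr -mulrN opprB mulrBr.
Qed.

Lemma neg_plaplacian0 (R : realType) (p : R) (g : int -> R[i]) n : 1 < p ->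
  0 < g n -> neg_plaplacian p 0 g n = (complex.Re (g n) `^ (p - 1))%:C.
Proof.
move=> p1; rewrite /neg_plaplacian /= expr0 mul1r /spow /modc.
case: (g n) => a b; rewrite ltcE /= => /andP[/eqP -> a0].
rewrite expr0n/= addr0 sqrtr_sqr ger0_norm ?ltW//.
rewrite -(@mulr_powRB1 _ a (p - 1)) ?subr_gt0 ?ltW//.
by apply/eqP; rewrite eq_complex /= !mulr0 !mul0r subr0 addr0 !eqxx.
Qed.

(* Summation by parts; the boundary terms vanish since u (l-1) = u N = 0. *)
Lemma energy_gap (R : realType) (p : R) (l m : nat) (u g : int -> R[i]) N :
  0 < p -> in_H l u -> (l <= N)%N -> u N%:Z = 0 ->
  energy p l m (nabla u) (nabla g) N - energy p l m.+1 u g N =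
  \sum_(l <= n < N.+1) complex.Re (neg_plaplacian p m (nabla g) n%:Z) *
    (ground_ratio p u g (n%:Z - 1) + ground_ratio p (nabla u) (nabla g) n%:Z
     - ground_ratio p u g n%:Z).
Proof.
move=> p0 hu lN uN; apply/eqP; rewrite -subr_eq0 -!sumrB.
pose T n := complex.Re (neg_plaplacian p m (nabla g) n%:Z) *
            ground_ratio p u g (n%:Z - 1).
rewrite (telescope_sumr_eq T) ?leqW//.
  rewrite /T -addn1 PoszD addrK !ground_ratio0 ?mulr0 ?subrr ?lt0r_neq0//.
  by apply: hu; lia.
move=> n _; rewrite /T neg_plaplacianS raddfB /= -addn1 PoszD addrK; ring.
Qed.

Lemma energy_nabla_le (R : realType) (p : R) (l m : nat) (u g : int -> R[i]) N :
  1 < p -> in_H l u -> in_H l g -> (l <= N)%N -> u N%:Z = 0 ->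
  (forall n : int, l%:Z <= n -> 0 < g n) ->
  (forall n : int, l%:Z <= n -> 0 < nabla g n) ->
  (forall n : int, l%:Z <= n -> 0 <= neg_plaplacian p m (nabla g) n) ->
  energy p l m.+1 u g N <= energy p l m (nabla u) (nabla g) N.
Proof.
move=> p1 hu hg lN uN g0 dg0 c0.
rewrite -subr_ge0 energy_gap// ?(lt_trans _ p1)//.
rewrite big_nat; apply: sumr_ge0 => n /andP[ln _].
have := c0 n%:Z ln; rewrite lecE => /andP[_ c0n].
by rewrite mulr_ge0// subr_ge0; apply: (@picone_le _ _ l) => //; exact: dg0.
Qed.

Lemma energy_nabla_eq (R : realType) (p : R) (l : nat) (u g : int -> R[i]) N :
  1 < p -> in_H l u -> in_H l g -> (l <= N)%N ->
  (forall n : nat, (N <= n)%N -> u n%:Z = 0) ->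
  (forall n : int, l%:Z <= n -> 0 < g n) ->
  (forall n : int, l%:Z <= n -> 0 < nabla g n) ->
  energy p l 1 u g N = energy p l 0 (nabla u) (nabla g) N ->
  forall n : int, u n = 0.
Proof.
move=> p1 hu hg lN uN g0 dg0 E.
have p0 : 0 < p by rewrite (lt_trans _ p1).
have /eqP := energy_gap 0 g p0 hu lN (uN _ (leqnn _)).
(* Strict positivity of this weight turns each vanishing summand below into a case of equality in
   Picone's inequality. *)
have c0 (n : int) : l%:Z <= n ->
    0 < complex.Re (neg_plaplacian p 0 (nabla g) n).
  move=> ln; rewrite neg_plaplacian0 ?dg0//= powR_gt0//.
  by have := dg0 _ ln; rewrite ltcE => /andP[].
rewrite E subrr eq_sym big_nat psumr_eq0; last first.
  move=> n /andP[ln _]; rewrite mulr_ge0 ?(ltW (c0 n%:Z ln))// subr_ge0.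
  by apply: (@picone_le _ _ l) => //; exact: dg0.
move=> /allP gap0.
(* All gap terms vanish: if u (n+1) = 0, the term at n+1 forces u n = 0. *)
have back k n : (N <= n + k)%N -> (l <= n)%N -> u n%:Z = 0.
  elim: k n => [|k IH] n nk ln; first by apply: uN; rewrite -(addn0 n).
  have [Nn|nN] := leqP N n; first exact: uN.
  have := gap0 n.+1; rewrite mem_index_iota ltnS nN leqW// => /(_ isT)/=.
  rewrite mulf_eq0 (gt_eqF (c0 _ _)) ?lez_nat ?leqW//=.
  rewrite (ground_ratio0 _ (lt0r_neq0 p0) (IH n.+1 _ _)) ?addSnnS ?leqW//.
  rewrite subr0 -addn1 PoszD addrK paddr_eq0 ?ground_ratio_ge0// => /andP[/eqP].
  by move=> /ground_ratio_eq0 + _; apply; exact: g0.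
move=> n; have [nl|ln] := ltP n l%:Z; first exact: hu.
case: n ln => // n ln; exact: (back N n (leq_addl _ _) ln).
Qed.

(** Used with [k = l] for the inequality and with [k = l - 1] in the equality case. *)
Lemma energy_iter_le (R : realType) (p : R) (l : nat) (u g : int -> R[i]) N :
  1 < p -> in_H l u -> in_H l g -> (l <= N)%N ->
  (forall k, (k < l)%N -> iter k (@nabla R) u N%:Z = 0) ->
  (forall (n : int) (k : nat), l%:Z <= n -> (k <= l)%N ->
     0 < iter k (@nabla R) g n) ->
  (forall (n : int) (k : nat), l%:Z <= n -> (1 <= k <= l - 1)%N ->
     0 <= neg_plaplacian p (l - k) (iter k (@nabla R) g) n) ->
  forall k, (k <= l)%N ->
  energy p l l u g N <=
  energy p l (l - k) (iter k (@nabla R) u) (iter k (@nabla R) g) N.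
Proof.
move=> p1 hu hg lN uN gpos hmid; elim=> [|k IH] kl; first by rewrite subn0.
apply: le_trans (IH (ltnW kl)) _; rewrite -[(l - k)%N]subSS subSn//.
apply: energy_nabla_le; rewrite ?uN//; try exact: in_H_iter_nabla.
- by move=> n ln; rewrite gpos // ltnW.
- by move=> n ln; rewrite (gpos n k.+1).
(* The last step, [k.+1 = l], lies outside [hmid]; there the operator has order 0 and yields a power
   of a positive number. *)
move=> n ln; have [kl1|kl1] := leqP k.+1 (l - 1); first exact: (hmid n k.+1).
have -> : (l - k.+1 = 0)%N by lia.
by rewrite neg_plaplacian0 ?ler0c ?powR_ge0//; exact: (gpos n k.+1).
Qed.

(** * Reduction of the series to finite sums *)

Lemma in_H0_vanish (R : realType) (l : nat) (u : int -> R[i]) :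
  in_H0 l u -> exists2 N : nat, (l <= N)%N &
  forall k n, (k <= l)%N -> (N <= n)%N -> iter k (@nabla R) u n%:Z = 0.
Proof.
move=> [_ /finite_seqP[s us]].
(* The sum of the absolute values of the points of the support dominates each of them. *)
pose M := (\sum_(x <- s) `|x|%N).+1.
have uM (n : int) : M%:Z <= n -> u n = 0.
  move=> Mn; apply/eqP/negP => /negP un.
  have xs : n \in s by have : [set` s]%classic n by rewrite -us.
  have : (`|n|%N <= \sum_(x <- s) `|x|%N)%N by rewrite (big_rem n)//= leq_addr.
  by rewrite /M in Mn; lia.
(* Each [nabla] extends the support by at most one to the right, so [M + l] serves all orders up to
   [l]. *)
have duM k : forall n : int, (M + k)%N%:Z <= n -> iter k (@nabla R) u n = 0.
  elim: k => [|k IH] n; first by rewrite addn0; exact: uM.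
  by move=> Mn; rewrite iterS /nabla !IH ?subrr//; lia.
exists (M + l)%N; first exact: leq_addl.
by move=> k n kl Mn; apply: duM; lia.
Qed.

Lemma eseries_finsupp (R : realType) (F : nat -> R) (l N : nat) : (l <= N)%N ->
  (forall n, (l <= n)%N -> 0 <= F n) -> (forall n, (N < n)%N -> F n = 0) ->
  (\sum_(l <= n <oo) (F n)%:E = (\sum_(l <= n < N.+1) F n)%:E)%E.
Proof.
move=> lN F0 FN; rewrite (nneseries_split _ (N.+1 - l)); last first.
  by move=> n ln; rewrite lee_fin F0.
rewrite subnKC ?leqW// eseries0 ?adde0 ?sumEFin//.
by move=> n Nn _; rewrite FN.
Qed.

(** * The weight inequality and its equality case *)

Lemma nabla_eq0 (R : realType) (l : nat) (u : int -> R[i]) :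
  in_H l u -> (forall n, nabla u n = 0) -> forall n, u n = 0.
Proof.
move=> hu du n; have [nl|ln] := ltP n l%:Z; first exact: hu.
have -> : n = l%:Z + `|n - l%:Z|%N%:Z by lia.
elim: `|_|%N => [|k IH].
  by have /eqP := du l%:Z; rewrite subr_eq0 addr0 => /eqP ->; apply: hu; lia.
have /eqP := du (l%:Z + k.+1%:Z); rewrite subr_eq0 => /eqP ->.
by rewrite -addn1 PoszD addrA addrK.
Qed.

(* On R[i], [0 < z] means that z is real and positive, and [0 <= z] that z is
   real and non-negative. *)
Theorem theorem2p7 (R : realType) (l : nat) (p : R) (hl : (1 <= l)%N)
  (hp : 1 < p) (g : int -> R[i]) (hg : in_H l g)
  (hpos : forall (n : int) (k : nat), l%:Z <= n -> (k <= l)%N ->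
     0 < iter k (@nabla R) g n)
  (hmid : forall (n : int) (k : nat), l%:Z <= n -> (1 <= k <= l - 1)%N ->
     0 <= neg_plaplacian p (l - k) (iter k (@nabla R) g) n)
  (hlap : forall n : int, l%:Z <= n -> 0 <= neg_plaplacian p l g n) :
  HRB_weight p l (rho_of p l g) /\ non_attainable p l (rho_of p l g).
Proof.
have p0 : p != 0 by rewrite gt_eqF// (lt_trans _ hp).
have rho0 (n : nat) : (l <= n)%N -> 0 <= rho_of p l g n.
  move=> ln; have := hlap n%:Z ln; rewrite lecE => /andP[_ c0].
  by rewrite divr_ge0 ?powR_ge0.
have rhsE (u : int -> R[i]) N : (l <= N)%N ->
    (forall n, (N <= n)%N -> u n%:Z = 0) ->
    HRB_rhs p l (rho_of p l g) u = (energy p l l u g N)%:E.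
  move=> lN uN; rewrite /HRB_rhs (@eseries_finsupp _ _ _ N)//.
  - by congr (_%:E); apply: eq_bigr => n _; rewrite mulrAC -mulrA.
  - by move=> n ln; rewrite mulr_ge0 ?powR_ge0 ?rho0.
  - by move=> n Nn; rewrite uN 1?ltnW// /modc Normc.normc0 powR0 ?mulr0.
have lhsE (u : int -> R[i]) N : (l <= N)%N ->
    (forall n, (N <= n)%N -> iter l (@nabla R) u n%:Z = 0) ->
    HRB_lhs p l u =
    (energy p l 0 (iter l (@nabla R) u) (iter l (@nabla R) g) N)%:E.
  move=> lN uN; rewrite /HRB_lhs (@eseries_finsupp _ _ _ N)//.
  (* The weight of order 0 is exactly the denominator of the ratio, so the two cancel. *)
  - congr (_%:E); apply: eq_big_nat => n /andP[ln _].
    have dg := hpos n%:Z l ln (leqnn l).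
    rewrite neg_plaplacian0//= mulrC divfK// gt_eqF// powR_gt0//.
    by move: dg; rewrite ltcE => /andP[].
  - by move=> n ln; rewrite powR_ge0.
  - by move=> n Nn; rewrite uN 1?ltnW// /modc Normc.normc0 powR0.
split; first (split=> // u hu); last move=> u hu.
  have [N lN uN] := in_H0_vanish hu; have [uH _] := hu.
  rewrite (rhsE u N lN (fun n => uN 0%N n isT)).
  rewrite (lhsE u N lN (fun n => uN l n (leqnn l))).
  rewrite lee_fin -[0%N in leRHS](subnn l).
  apply: energy_iter_le => // k kl; exact: uN (ltnW kl) (leqnn N).
have [N lN uN] := in_H0_vanish hu; have [uH _] := hu.
rewrite (rhsE u N lN (fun n => uN 0%N n isT)).
rewrite (lhsE u N lN (fun n => uN l n (leqnn l))).
move=> [E]; have [m lm] : exists m, l = m.+1 by exists l.-1; rewrite prednK.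
have ml : (m <= l)%N by rewrite lm.
have l1 : (l - m = 1)%N by rewrite lm subSnn.
have mH v : in_H l v -> in_H l (iter m (@nabla R) v) by exact: in_H_iter_nabla.
have g0 (n : int) : l%:Z <= n -> 0 < iter m (@nabla R) g n.
  by move=> ln; exact: hpos.
have dg0 (n : int) : l%:Z <= n -> 0 < nabla (iter m (@nabla R) g) n.
  by move=> ln; rewrite -iterS -lm hpos.
have du0 : forall n, iter m (@nabla R) u n = 0.
  apply: (@energy_nabla_eq _ p l _ (iter m (@nabla R) g) N) => //; try exact: mH.
    by move=> n Nn; exact: uN.
  (* By [E] the two ends of the chain coincide, so the energy at [m = l - 1], squeezed between them,
     equals the last one. *)
  apply/eqP; rewrite eq_le; apply/andP; split.
    apply: energy_nabla_le; rewrite ?uN//; try exact: mH.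
    move=> n ln.
    by rewrite neg_plaplacian0 ?dg0// ler0c powR_ge0.
  rewrite -!iterS -lm E -l1; apply: energy_iter_le => // k kl.
  exact: uN (ltnW kl) (leqnn N).
(* Descent from order [l - 1]: a sequence with zero difference is constant, and it vanishes to the
   left of [l]. *)
elim: m {lm ml l1 mH g0 dg0} du0 => // k IH du; apply: IH.
exact: nabla_eq0 (in_H_iter_nabla k uH) du.
Qed.
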